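(* Let $M$ be a nice topological space with Poincaré polynomial $P_M(t) = \sum_i b_i(M) t^i \in \mathbb Z[t]$, and define $Q_M(u) \in \mathbb Z[u]$ by $P_M(t) = Q_M(1+t)$. Then $$Q_M(u) = \sum_j \chi_j(M)\, u^j.$$
   Context: A topological space is called nice if it is, or is homotopy equivalent to, a finite CW complex. For a nice space $M$, its Betti numbers are $b_i(M) = \mathrm{rank}_{\mathbb Z}\, H_i(M, \mathbb Z)$. For any integer $j \ge 0$, the $j$-th (higher) Euler characteristic of $M$ is $$\chi_j(M) = \sum_i (-1)^{i-j} \binom{i}{j} b_i(M) \in \mathbb Z.$$ *)

(* Defs.v *)
From HB Require Import structures.
From mathcomp Require Import all_boot all_order all_algebra.
From mathcomp Require Import generic_quotient ring_quotient.
From mathcomp.multinomials Require Import freeg.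
From mathcomp Require Import mathcomp_extra boolp classical_sets functions.
From mathcomp Require Import cardinality fsbigop set_interval reals topology.
From mathcomp Require Import normedtype.

Set Implicit Arguments.
Unset Strict Implicit.
Unset Printing Implicit Defensive.

Import Order.TTheory GRing.Theory Num.Theory.
Import numFieldNormedType.Exports.

Local Open Scope classical_set_scope.
Local Open Scope ring_scope.

Section NiceSpaces.
Variable R : realType.

Definition disk (n : nat) : set 'rV[R]_n :=
  [set x | \sum_(i < n) x 0 i ^+ 2 <= 1].
Arguments disk : clear implicits.

Definition disk_interior (n : nat) : set (disk n) :=
  [set x | \sum_(i < n) (set_val x : 'rV[R]_n) 0 i ^+ 2 < 1].
Arguments disk_interior : clear implicits.

Definition disk_boundary (n : nat) : set (disk n) :=
  [set x | \sum_(i < n) (set_val x : 'rV[R]_n) 0 i ^+ 2 = 1].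
Arguments disk_boundary : clear implicits.

(* Whitehead's definition of a CW structure, with finitely many cells (so that
   closure-finiteness is automatic).  The cell [e] is the image of the interior
   of the disk under the characteristic map [char_map e]. *)
Record finite_CW_structure (X : topologicalType) := FiniteCWStructure {
  cell : finType;
  cell_dim : cell -> nat;
  char_map : forall e : cell, disk (cell_dim e) -> X;
  open_cell := fun e : cell => char_map (e := e) @` disk_interior (cell_dim e);
  char_map_continuous : forall e, continuous (@char_map e);
  open_cell_partition : forall p : X, exists! e, open_cell e p;
  (* [char_map e] restricts to a homeomorphism from the open disk onto its
     image, the latter with the subspace topology *)
  char_map_inj : forall e,
    {in disk_interior (cell_dim e) &, injective (@char_map e)};
  char_map_open : forall e (U : set (disk (cell_dim e))),
    open U -> U `<=` disk_interior (cell_dim e) ->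
    exists2 V : set X, open V & char_map (e := e) @` U = V `&` open_cell e;
  char_map_boundary : forall e x, disk_boundary (cell_dim e) x ->
    exists2 e', (cell_dim e' < cell_dim e)%N & open_cell e' (char_map x);
  CW_weak_topology : forall A : set X,
    (forall e, closed (char_map (e := e) @^-1` A)) -> closed A
}.

Definition finite_CW_complex (X : topologicalType) : Prop :=
  hausdorff_space X /\ inhabited (finite_CW_structure X).

Definition homotopic (X Y : topologicalType) (f g : X -> Y) : Prop :=
  exists H : X * R -> Y,
    [/\ {within [set: X] `*` `[0, 1], continuous H},
        forall x, H (x, 0) = f x & forall x, H (x, 1) = g x].

Definition homotopy_equivalent (X Y : topologicalType) : Prop :=
  exists (f : X -> Y) (g : Y -> X),
    [/\ continuous f, continuous g,
        homotopic (g \o f) idfun & homotopic (f \o g) idfun].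

Definition nice (X : topologicalType) : Prop :=
  finite_CW_complex X \/
  exists2 Y : topologicalType, finite_CW_complex Y & homotopy_equivalent X Y.

End NiceSpaces.

Section SingularHomology.
Variable R : realType.

Definition stdsimplex (n : nat) : set 'rV[R]_n.+1 :=
  [set x | (forall i, 0 <= x 0 i) /\ \sum_(i < n.+1) x 0 i = 1].
Arguments stdsimplex : clear implicits.

(* the [i]-th coface inserts a zero in position [i] *)
Definition coface_row (n : nat) (i : 'I_n.+2) (x : 'rV[R]_n.+1) : 'rV[R]_n.+2 :=
  \row_j oapp (fun k => x 0 k) 0 (unlift i j).

Lemma coface_subproof (n : nat) (i : 'I_n.+2) (x : stdsimplex n) :
  coface_row i (set_val x) \in stdsimplex n.+1.
Proof.
case: x => x xS; have [x0 x1] := set_mem xS; apply/mem_set; split=> [j|].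
  by rewrite mxE; case: unlift => [k|] /=.
rewrite (bigD1_ord i) //= mxE unlift_none add0r -[RHS]x1.
by apply: eq_bigr => k _; rewrite mxE liftK.
Qed.

Definition coface (n : nat) (i : 'I_n.+2) (x : stdsimplex n) :
  stdsimplex n.+1 := SigSub (coface_subproof i x).

Lemma coface_continuous (n : nat) (i : 'I_n.+2) : continuous (coface i).
Proof.
apply: (@continuous_comp_initial _ _ _ set_val) => x.
apply: (@continuous_comp _ _ _ set_val (coface_row i)).
  exact: initial_continuous.
move=> A [P nP sPA].
exists (fun a k => P a (fintype.lift i k)) => [a k|y Py].
  by move: (nP a (fintype.lift i k)); rewrite !mxE liftK (ord1 a).
apply: sPA => a j; case: (unliftP i j) => [k|] ->.
  by rewrite mxE liftK (ord1 a); exact: Py.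
by move: (nP a i); rewrite !mxE unlift_none /= => /nbhs_singleton.
Qed.

HB.instance Definition _ (n : nat) (i : 'I_n.+2) :=
  isContinuous.Build _ _ (coface i) (@coface_continuous n i).

Variable M : topologicalType.

Definition singular_simplex (n : nat) := continuousType (stdsimplex n) M.

Definition face (n : nat) (i : 'I_n.+2) (s : singular_simplex n.+1) :
  singular_simplex n := s \o coface i.

Definition chain (n : nat) : zmodType := {freeg (singular_simplex n) / int}.

Definition boundary (n : nat) : chain n.+1 -> chain n :=
  fglift (fun s => \sum_(i < n.+2) << (-1) ^+ i *g face i s >>).

Lemma boundary_is_zmod_morphism (n : nat) : zmod_morphism (@boundary n).
Proof. exact: lift_is_additive. Qed.

HB.instance Definition _ (n : nat) :=
  GRing.isZmodMorphism.Build _ _ (@boundary n) (@boundary_is_zmod_morphism n).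

Definition is_cycle (n : nat) : {pred chain n} :=
  if n is m.+1 then fun z => boundary z == 0 else xpredT.

Lemma is_cycle_zmod_closed (n : nat) : zmod_closed (@is_cycle n).
Proof.
case: n => [//|n]; split=> [|x y]; rewrite !unfold_in /= ?raddf0 //.
by rewrite raddfB /= => /eqP-> /eqP->; rewrite subrr.
Qed.

HB.instance Definition _ (n : nat) :=
  GRing.isZmodClosed.Build (chain n) (@is_cycle n) (@is_cycle_zmod_closed n).

Definition cycle (n : nat) := {z : chain n | is_cycle z}.
HB.instance Definition _ (n : nat) := SubChoice.on (cycle n).
HB.instance Definition _ (n : nat) :=
  [SubChoice_isSubZmodule of cycle n by <:].

Definition is_boundary (n : nat) : {pred cycle n} :=
  fun z => `[< exists c : chain n.+1, boundary c = val z >].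

Arguments is_boundary : clear implicits.

Lemma is_boundary_zmod_closed (n : nat) : zmod_closed (is_boundary n).
Proof.
split=> [|x y]; rewrite !unfold_in.
  by apply/asboolP; exists 0; rewrite !raddf0.
move=> /asboolP[a da] /asboolP[b db]; apply/asboolP; exists (a - b).
transitivity (boundary a - boundary b); first exact: raddfB.
by rewrite da db -raddfB.
Qed.

HB.instance Definition _ (n : nat) :=
  GRing.isZmodClosed.Build (cycle n) (is_boundary n)
    (@is_boundary_zmod_closed n).

Definition homology (n : nat) : zmodType :=
  ring_quotient.Quotient.quot (is_boundary n).

End SingularHomology.

Definition Z_independent (A : zmodType) (k : nat) (v : 'I_k -> A) : Prop :=
  forall c : 'I_k -> int, \sum_(i < k) v i *~ c i = 0 -> forall i, c i = 0.

Definition has_rank (A : zmodType) (k : nat) : Prop :=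
  (exists v : 'I_k -> A, Z_independent v) /\
  (forall (m : nat) (v : 'I_m -> A), Z_independent v -> (m <= k)%N).

(* zero by convention when the rank is infinite *)
Definition Z_rank (A : zmodType) : nat := xget 0%N [set k | has_rank A k].

Definition betti (R : realType) (M : topologicalType) (i : nat) : nat :=
  Z_rank (homology R M i).

(* The sums over all natural numbers are finitely supported for a nice [M];
   for an infinite support [\sum_(i \in _)] is zero by convention. *)
Definition poincare_poly (R : realType) (M : topologicalType) : {poly int} :=
  \sum_(i \in [set: nat]) (betti R M i)%:Z *: 'X^i.

Definition euler_char (R : realType) (M : topologicalType) (j : nat) : int :=
  \sum_(i \in [set: nat])
    (-1) ^ (i%:Z - j%:Z) * 'C(i, j)%:Z * (betti R M i)%:Z.

(* Main.v *)
Require Import Defs.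
From mathcomp Require Import all_boot all_order all_algebra.
From mathcomp Require Import classical_sets fsbigop reals topology.
From mathcomp Require Import boolp cardinality finmap.

(** Inverting [P(t) = Q(1 + t)] gives [Q(u) = P(u - 1)], and expanding each
    [(u - 1) ^ i] by the binomial formula shows that the coefficient of [u ^ j]
    in [Q] is [\sum_i (-1) ^ (i - j) * 'C(i, j) * b i], the [j]-th Euler
    characteristic.  This is a fact about an arbitrary sequence [b] of integers,
    [binomial_shift]; the corollary is the case of the Betti numbers.

    The sums are indexed by all natural numbers, and such a sum is zero when
    infinitely many of its terms are nonzero.  If [b] vanishes from [N] on, all
    sums are over [i < N] and the argument above applies.  Otherwise the sums
    defining [P] and each of the coefficients have infinite support, since
    ['C(i, j)] is nonzero for all [i >= j]; by [fsum_nat_unbounded], [P], hence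
    [Q], and all the coefficients are then zero, and both sides agree. *)

Local Open Scope classical_set_scope.
Local Open Scope ring_scope.

Import GRing.Theory.

Lemma fsum_nat_bounded (V : nmodType) (f : nat -> V) (N : nat) :
  (forall i, (N <= i)%N -> f i = 0) ->
  \sum_(i \in [set: nat]) f i = \sum_(i < N) f i.
Proof.
move=> f0; rewrite (fsbigE (index_iota 0 N)) ?iota_uniq //.
  by rewrite -(big_mkord xpredT f); apply: eq_bigl => i; rewrite in_setT.
by move=> i _; rewrite mem_index_iota -leqNgt => /f0.
Qed.

(** A set of natural numbers is finite exactly when it is bounded, so a
    sequence that is not eventually zero has infinite support, and its sum takes
    the default value. *)
Lemma fsum_nat_unbounded (V : nmodType) (f : nat -> V) :
  ~ (exists N : nat, forall i, (N <= i)%N -> f i = 0) ->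
  \sum_(i \in [set: nat]) f i = 0.
Proof.
move=> unbounded; apply: fsbig_dflt; rewrite setTI => /finite_fsetP[X eqX].
apply: unbounded; exists (\max_(i <- X) i).+1 => i ltXi.
apply: contrapT => fi_neq0.
have Xi : i \in X by have : [set` X] i by rewrite -eqX.
have : (i <= \max_(k <- X) k)%N by apply: leq_bigmax_seq.
by rewrite leqNgt ltXi.
Qed.

Lemma exp_subX1 (i : nat) :
  ('X - 1) ^+ i =
    \sum_(j < i.+1) ((-1) ^ (i%:Z - j%:Z) * 'C(i, j)%:Z) *: 'X^j :> {poly int}.
Proof.
rewrite addrC exprDn; apply: eq_bigr => j _.
rewrite subzn -1?ltnS // -exprnP -scalerA -natz scaler_nat.
by rewrite -scalerMnr -mul_polyC rmorphXn /= polyCN.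
Qed.

Lemma binomial_shift_bounded (b : nat -> int) (N : nat) :
  (\sum_(i < N) b i *: 'X^i) \Po ('X - 1) =
    \sum_(j < N)
      (\sum_(i < N) (-1) ^ (i%:Z - j%:Z) * 'C(i, j)%:Z * b i) *: 'X^j.
Proof.
rewrite raddf_sum /=.
under [RHS]eq_bigr do rewrite scaler_suml.
rewrite exchange_big /=; apply: eq_bigr => i _.
rewrite comp_polyZ comp_Xn_poly exp_subX1 scaler_sumr.
(* the terms with [i < j < N] vanish along with ['C(i, j)] *)
rewrite (big_ord_widen N
  (fun j => b i *: (((-1) ^ (i%:Z - j%:Z) * 'C(i, j)%:Z) *: 'X^j))) //.
rewrite big_mkcond; apply: eq_bigr => j _; rewrite scalerA mulrC ltnS.
by case: leqP => // ltij; rewrite bin_small // mulr0 mul0r scale0r.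
Qed.

Lemma binomial_shift (b : nat -> int) (Q : {poly int}) :
  \sum_(i \in [set: nat]) b i *: 'X^i = Q \Po (1 + 'X) ->
  Q = \sum_(j \in [set: nat])
        (\sum_(i \in [set: nat]) (-1) ^ (i%:Z - j%:Z) * 'C(i, j)%:Z * b i)
          *: 'X^j.
Proof.
rewrite addrC => eqQ.
have -> : Q = (\sum_(i \in [set: nat]) b i *: 'X^i) \Po ('X - 1).
  by rewrite eqQ -polyC1 comp_polyXaddC_K.
have [[N b0]|unbounded] := pselect (exists N, forall i, (N <= i)%N -> b i = 0).
  have coefE j :
      \sum_(i \in [set: nat]) (-1) ^ (i%:Z - j%:Z) * 'C(i, j)%:Z * b i =
      \sum_(i < N) (-1) ^ (i%:Z - j%:Z) * 'C(i, j)%:Z * b i.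
    by apply: fsum_nat_bounded => i /b0 ->; rewrite mulr0.
  rewrite (fsum_nat_bounded _ _ N) => [|i /b0 ->]; last by rewrite scale0r.
  rewrite binomial_shift_bounded (fsum_nat_bounded _ _ N) => [|j leNj].
    by apply: eq_bigr => j _; rewrite coefE.
  rewrite coefE big1 ?scale0r // => i _.
  by rewrite bin_small ?mulr0 ?mul0r // (leq_trans _ leNj).
rewrite fsum_nat_unbounded => [|[N bX0]]; last first.
  apply: unbounded; exists N => i /bX0/eqP.
  rewrite -mul_polyC mulf_eq0 polyC_eq0 (negbTE (monic_neq0 (monicXn _ i))).
  by rewrite orbF => /eqP.
rewrite comp_poly0 fsbig1 // => j _.
rewrite fsum_nat_unbounded ?scale0r // => -[N coef0]; apply: unbounded.
(* past [j] the factor ['C(i, j)] is nonzero, so only [b i] can vanish *)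
exists (maxn N j) => i; rewrite geq_max => /andP[/coef0/eqP + leji].
rewrite !mulf_eq0 expfz_eq0 oppr_eq0 oner_eq0 andbF /=.
by rewrite eqz_nat -leqn0 leqNgt bin_gt0 leji => /eqP.
Qed.

Theorem corollary1p7 (R : realType) (M : topologicalType) (hM : nice R M)
    (Q : {poly int}) (hQ : poincare_poly R M = Q \Po (1 + 'X)) :
  Q = \sum_(j \in [set: nat]) euler_char R M j *: 'X^j.
Proof. exact: binomial_shift hQ. Qed.
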